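(* Let $\mathbb{F}$ be an infinite field of arbitrary characteristic, let $\mathsf{A}_1$ be the Weyl algebra over $\mathbb{F}$ with generators $x,y$, and let $\mathsf{V}=\mathbb{F}\text{-}\mathrm{span}\{x,y\}\subset\mathsf{A}_1$. Any weak polynomial identity for the pair $(\mathsf{A}_1,\mathsf{V})$ of degree $4$ lies in the L-ideal $\mathcal{I}$ of $\mathbb{F}\langle X\rangle$ generated by $\Gamma_3$, $\mathrm{St}_3$, and $T_4$.
   Context: The Weyl algebra is the unital associative algebra $\mathsf{A}_1=\mathbb{F}\langle x,y\rangle/(yx-xy-1)$. $\mathbb{F}\langle X\rangle$ is the free unital associative $\mathbb{F}$-algebra on free generators $x_1,x_2,\ldots$. A weak polynomial identity for the pair $(\mathsf{A}_1,\mathsf{V})$ is an element $f(x_1,\ldots,x_m)\in\mathbb{F}\langle X\rangle$ such that $f(v_1,\ldots,v_m)=0$ in $\mathsf{A}_1$ for all $v_1,\ldots,v_m\in\mathsf{V}$. With $[a,b]=ab-ba$, put $$\Gamma_3(x_1,x_2,x_3)=[[x_1,x_2],x_3],\qquad \mathrm{St}_3(x_1,x_2,x_3)=x_1[x_2,x_3]-x_2[x_1,x_3]+x_3[x_1,x_2],$$ $$T_4(x_1,x_2,x_3,x_4)=[x_1,x_2][x_3,x_4]-[x_1,x_3][x_2,x_4]+[x_2,x_3][x_1,x_4].$$ The L-ideal generated by $f_1,\ldots,f_k\in\mathbb{F}\langle X\rangle$ is the $\mathbb{F}$-span of all $f^{(1)}f_i(g_1,\ldots,g_m)f^{(2)}$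 with $f^{(1)},f^{(2)}\in\mathbb{F}\langle X\rangle$, $g_1,\ldots,g_m$ linear combinations of letters $x_1,x_2,\ldots$, and $1\le i\le k$. Thus $\mathcal{I}$ is the two-sided ideal of $\mathbb{F}\langle X\rangle$ generated by $\Gamma_3(x_i,x_j,x_k)$, $\mathrm{St}_3(x_i,x_j,x_k)$, $T_4(x_i,x_j,x_k,x_l)$ for all $i,j,k,l>0$. *)

(* Defs.v *)
From HB Require Import structures.
From mathcomp Require Import all_boot all_algebra.
From mathcomp Require Import generic_quotient ring_quotient finmap monalg.
From mathcomp Require Import mathcomp_extra boolp classical_sets cardinality.

Set Implicit Arguments.
Unset Strict Implicit.
Unset Printing Implicit Defensive.

Import GRing.Theory.
Local Open Scope ring_scope.

Fact malg_scalerAr (K : monomType) (R : comNzRingType) (c : R)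
  (f g : {malg R[K]}) : c *: (f * g) = f * (c *: g).
Proof.
apply/malgP => k; rewrite mcoeffZ (mcoeffMlw k (fsubset_refl _) (msuppZ_le c g)).
rewrite mcoeffMl mulr_sumr; apply: eq_bigr => k1 _.
rewrite mulr_sumr; apply: eq_bigr => k2 _.
by rewrite mcoeffZ mulrnAr mulrCA.
Qed.

(* An alias of [{malg F[{fmonom I}]}], on which the library provides only a   *)
(* left algebra structure.                                                    *)
Definition freeAlg (F : fieldType) (I : choiceType) : Type :=
  {malg F[{fmonom I}]}.

HB.instance Definition _ F I := GRing.Lalgebra.copy (freeAlg F I)
  {malg F[{fmonom I}]}.

Section FreeAlg.
Variables (F : fieldType) (I : choiceType).
Implicit Types (f g : freeAlg F I).

HB.instance Definition _ := GRing.Lalgebra_isAlgebra.Build F (freeAlg F I)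
  (@malg_scalerAr _ F).

Definition gen (i : I) : freeAlg F I := << fmu i >>.

Definition degree f : nat := \max_(m <- msupp f) fdeg m.

Definition eval (A : algType F) (v : I -> A) f : A :=
  mmap (in_alg A) (fun m : {fmonom I} => \prod_(i <- (m : seq I)) v i) f.

Section Eval.
Variables (A : algType F) (v : I -> A).

Let h (m : {fmonom I}) : A := \prod_(i <- (m : seq I)) v i.

Let h_mmorphism : mmorphism h.
Proof.
by split=> [m1 m2|]; rewrite /h ?fmM ?fm1 ?big_nil ?big_cat.
Qed.

HB.instance Definition _ := isMultiplicative.Build {fmonom I} A h h_mmorphism.

Lemma eval_is_zmod : zmod_morphism (@eval A v).
Proof. exact: (@mmap_is_additive _ _ _ (in_alg A) h). Qed.

Lemma eval_is_monoid : monoid_morphism (@eval A v).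
Proof.
have [|eM e1] := @commr_mmap_is_multiplicative _ _ _ (in_alg A) h.
  by move=> g m m'; rewrite /GRing.comm /= mulr_algl mulr_algr.
by split.
Qed.

Lemma eval_is_scalable : scalable (@eval A v).
Proof.
by move=> c f; rewrite /eval (@mmapZ _ _ _ (in_alg A) h) /= mulr_algl.
Qed.

HB.instance Definition _ :=
  GRing.isZmodMorphism.Build (freeAlg F I) A (@eval A v) eval_is_zmod.
HB.instance Definition _ :=
  GRing.isMonoidMorphism.Build (freeAlg F I) A (@eval A v) eval_is_monoid.
HB.instance Definition _ :=
  GRing.isScalable.Build F (freeAlg F I) A *:%R (@eval A v) eval_is_scalable.

Lemma eval_gen i : eval v (gen i) = v i.
Proof. by rewrite /eval mmapU /= scale1r mul1r fmU big_seq1. Qed.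

End Eval.
End FreeAlg.

Arguments gen {F I} i.

(* Scalars need not appear explicitly: when [R] is an algebra they are        *)
(* absorbed by the left factor, so this is also the linear span of the        *)
(* products [a * s * b] with [s] in [S].                                      *)
Definition ideal_gen (R : nzRingType) (S : R -> Prop) (u : R) : Prop :=
  exists2 s : seq (R * R * R),
    (forall t, t \in s -> S t.1.2) & u = \sum_(t <- s) t.1.1 * t.1.2 * t.2.

Section IdealGen.
Variables (R : nzRingType) (S : R -> Prop).

Lemma ideal_genD u v :
  ideal_gen S u -> ideal_gen S v -> ideal_gen S (u + v).
Proof.
move=> [s Ss ->] [t St ->]; exists (s ++ t); last by rewrite big_cat.
by move=> x; rewrite mem_cat => /orP[/Ss|/St].
Qed.

Lemma ideal_genM a b u : ideal_gen S u -> ideal_gen S (a * u * b).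
Proof.
move=> [s Ss ->]; exists [seq (a * t.1.1, t.1.2, t.2 * b) | t <- s].
  by move=> x /mapP[t /Ss ? ->].
rewrite big_map mulr_sumr mulr_suml; apply: eq_bigr => t _ /=.
by rewrite !mulrA.
Qed.

Lemma ideal_gen_zmod : zmod_closed [pred u | `[< ideal_gen S u >]].
Proof.
split=> [|u v]; first by apply/asboolP; exists [::]; rewrite ?big_nil.
move=> /asboolP Su /asboolP Sv; apply/asboolP; apply: ideal_genD => //.
by rewrite -[- v]mulr1 -mulN1r; apply: ideal_genM.
Qed.

End IdealGen.

Section Weyl.
Variable F : fieldType.

(* The letters [gen false] and [gen true] stand for [x] and [y].              *)
Local Notation Fxy := (freeAlg F bool).

Definition weyl_rel : Fxy :=
  gen true * gen false - gen false * gen true - 1.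

Definition weyl_ideal : {pred Fxy} :=
  [pred u | `[< ideal_gen (eq weyl_rel) u >]].

HB.instance Definition _ := GRing.isZmodClosed.Build Fxy weyl_ideal
  (ideal_gen_zmod (eq weyl_rel)).

Lemma weyl_idealM a b u : u \in weyl_ideal -> a * u * b \in weyl_ideal.
Proof. by move=> /asboolP h; apply/asboolP; apply: ideal_genM. Qed.

(* The Weyl algebra is not the zero ring: it acts on polynomials, [x] by      *)
(* multiplication by ['X] and [y] by differentiation.                         *)
Let act (s : seq bool) (p : {poly F}) : {poly F} :=
  foldr (fun b (q : {poly F}) => if b then q^`() else 'X * q) p s.

Let actB s p q : act s (p - q) = act s p - act s q.
Proof.
by elim: s => //= b s ->; case: b; rewrite ?derivB ?mulrBr.
Qed.

Let act_cat s t p : act (s ++ t) p = act s (act t p).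
Proof. by rewrite /act foldr_cat. Qed.

Let tr (f : {malg F[{fmonom bool}]}) : F :=
  mmap idfun (fun m : {fmonom bool} => (act m 1)`_0) f.

Lemma weyl_ideal_proper : 1 \notin weyl_ideal.
Proof.
apply/asboolP => -[s Ss e].
have: tr 1 = 0; last first.
  by rewrite /tr mmapU /= fm1 /= mul1r coefC => /eqP; rewrite oner_eq0.
rewrite (e : (1 : {malg F[{fmonom bool}]}) = _) /tr raddf_sum.
rewrite big_seq big1 // => -[[a r] b] /Ss /= <- {s Ss e r}.
have UM (c d : F) (k l : {fmonom bool}) :
    (<< c *g k >> : Fxy) * << d *g l >> = << c * d *g mmul k l >>.
  exact: fgmulUU.
have aE : a = \sum_(k <- msupp a) (<< a@_k *g k >> : Fxy) by exact: monalgE.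
have bE : b = \sum_(k <- msupp b) (<< b@_k *g k >> : Fxy) by exact: monalgE.
rewrite -mulrA {1}aE mulr_suml raddf_sum big1 // => k _.
rewrite mulrA {1}bE mulr_sumr raddf_sum big1 // => l _.
rewrite /weyl_rel /gen.
rewrite !(mulrBr, mulrBl) mulr1 !raddfB /=.
rewrite !UM !mmapU /= !mulr1.
rewrite -!mulrBr -!coefB !fmM !fmU -!catA !act_cat -!actB /=.
rewrite derivM derivX mul1r addrK subrr.
suff -> : act k 0 = 0 by rewrite coef0 mulr0.
by rewrite -[X in act k X](subrr 0) actB subrr.
Qed.

Definition weyl : Type := {ideal_quot weyl_ideal}.
HB.instance Definition _ := GRing.Zmodule.on weyl.

Definition weyl_pi (f : Fxy) : weyl := \pi_({ideal_quot weyl_ideal})%qT f.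

Lemma weyl_pi_eq f g : (weyl_pi f = weyl_pi g) <-> f - g \in weyl_ideal.
Proof.
by rewrite Quotient.idealrBE; split => [h|/eqP h] //; apply/eqP.
Qed.

Let wrepr (u : weyl) : Fxy := repr (u : {ideal_quot weyl_ideal}).
Let wreprK : cancel wrepr weyl_pi. Proof. exact: reprK. Qed.

Lemma weyl_piD f g : weyl_pi (f + g) = weyl_pi f + weyl_pi g.
Proof. by rewrite /weyl_pi raddfD. Qed.

Let one : weyl := weyl_pi 1.
(* Locked so that unification does not compare representatives.               *)
Let mul : weyl -> weyl -> weyl :=
  locked (fun u v => weyl_pi (wrepr u * wrepr v)).
Let scale : F -> weyl -> weyl := locked (fun c u => weyl_pi (c *: wrepr u)).

Let pi_mul f g : weyl_pi (f * g) = mul (weyl_pi f) (weyl_pi g).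
Proof.
rewrite /mul -lock; apply/weyl_pi_eq; set f' := wrepr _; set g' := wrepr _.
have hf : f - f' \in weyl_ideal by apply/weyl_pi_eq; rewrite wreprK.
have hg : g - g' \in weyl_ideal by apply/weyl_pi_eq; rewrite wreprK.
have -> : f * g - f' * g' = 1 * (f - f') * g + f' * (g - g') * 1.
  by rewrite mul1r mulr1 mulrBl mulrBr addrA subrK.
by apply: rpredD; apply: weyl_idealM.
Qed.

Let pi_scale c f : weyl_pi (c *: f) = scale c (weyl_pi f).
Proof.
rewrite /scale -lock; apply/weyl_pi_eq; set f' := wrepr _.
have hf : f - f' \in weyl_ideal by apply/weyl_pi_eq; rewrite wreprK.
rewrite -scalerBr -mulr_algl -[_ * _]mulr1; exact: weyl_idealM.
Qed.

Let mulA : associative mul.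
Proof.
move=> u v w; rewrite -(wreprK u) -(wreprK v) -(wreprK w).
by rewrite -!pi_mul mulrA.
Qed.
Let mul1 : left_id one mul.
Proof. by move=> u; rewrite -(wreprK u) -pi_mul mul1r. Qed.
Let mulq1 : right_id one mul.
Proof. by move=> u; rewrite -(wreprK u) -pi_mul mulr1. Qed.
Let mulDl : left_distributive mul +%R.
Proof.
move=> u v w; rewrite -(wreprK u) -(wreprK v) -(wreprK w).
by rewrite -weyl_piD -!pi_mul mulrDl weyl_piD.
Qed.
Let mulDr : right_distributive mul +%R.
Proof.
move=> u v w; rewrite -(wreprK u) -(wreprK v) -(wreprK w).
by rewrite -weyl_piD -!pi_mul mulrDr weyl_piD.
Qed.
Let one_neq0 : one != 0.
Proof.
apply/eqP => h; have: weyl_pi 1 = weyl_pi 0.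
  by rewrite -/one h /weyl_pi raddf0.
by move/weyl_pi_eq; rewrite subr0; apply/negP/weyl_ideal_proper.
Qed.

HB.instance Definition _ := GRing.Zmodule_isNzRing.Build weyl
  mulA mul1 mulq1 mulDl mulDr one_neq0.

Let scaleA a b u : scale a (scale b u) = scale (a * b) u.
Proof. by rewrite -(wreprK u) -!pi_scale scalerA. Qed.
Let scale1 : left_id 1 scale.
Proof. by move=> u; rewrite -(wreprK u) -pi_scale scale1r. Qed.
Let scaleDr : right_distributive scale +%R.
Proof.
move=> a u v; rewrite -(wreprK u) -(wreprK v).
by rewrite -weyl_piD -!pi_scale scalerDr weyl_piD.
Qed.
Let scaleDl u : {morph scale^~ u : a b / a + b}.
Proof.
by move=> a b; rewrite -(wreprK u) -!pi_scale scalerDl weyl_piD.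
Qed.

HB.instance Definition _ := GRing.Zmodule_isLmodule.Build F weyl
  scaleA scale1 scaleDr scaleDl.

Let scaleAl a (u v : weyl) : a *: (u * v) = (a *: u) * v.
Proof.
rewrite -(wreprK u) -(wreprK v) /GRing.mul /GRing.scale /=.
by rewrite -pi_mul -!pi_scale -pi_mul scalerAl.
Qed.
HB.instance Definition _ := GRing.Lmodule_isLalgebra.Build F weyl scaleAl.

Let scaleAr a (u v : weyl) : a *: (u * v) = u * (a *: v).
Proof.
rewrite -(wreprK u) -(wreprK v) /GRing.mul /GRing.scale /=.
by rewrite -pi_mul -!pi_scale -pi_mul scalerAr.
Qed.
HB.instance Definition _ := GRing.Lalgebra_isAlgebra.Build F weyl scaleAr.

Lemma weyl_piM f g : weyl_pi (f * g) = weyl_pi f * weyl_pi g.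
Proof. exact: pi_mul. Qed.

Lemma weyl_pi1 : weyl_pi 1 = 1.
Proof. by []. Qed.

Lemma weyl_piZ c f : weyl_pi (c *: f) = c *: weyl_pi f.
Proof. exact: pi_scale. Qed.

Definition weyl_x : weyl := weyl_pi (gen false).
Definition weyl_y : weyl := weyl_pi (gen true).

Lemma weyl_yx : weyl_y * weyl_x - weyl_x * weyl_y = 1.
Proof.
apply/eqP; rewrite subr_eq -weyl_pi1 -!weyl_piM -weyl_piD.
apply/eqP/weyl_pi_eq; apply/asboolP.
exists [:: (1, weyl_rel, 1)]; first by move=> t; rewrite inE => /eqP ->.
by rewrite big_seq1 mul1r mulr1 opprD addrA addrAC.
Qed.

Definition weyl_V (v : weyl) : Prop :=
  exists a b : F, v = a *: weyl_x + b *: weyl_y.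

End Weyl.

Definition lie (R : nzRingType) (a b : R) : R := a * b - b * a.

Section WeakIdentities.
Variable F : fieldType.

(* The letters are numbered from 0: [gen i] is x_(i+1).                       *)
Local Notation FX := (freeAlg F nat).

Definition weak_identity (A : algType F) (V : A -> Prop) (f : FX) : Prop :=
  forall v : nat -> A, (forall i, V (v i)) -> eval v f = 0.

Definition linear_form (g : FX) : Prop :=
  exists (n : nat) (c : nat -> F), g = \sum_(i < n) c i *: gen (i : nat).

Definition L_ideal (fs : seq FX) : FX -> Prop :=
  ideal_gen (fun h => exists f (g : nat -> FX),
    [/\ f \in fs, forall i, linear_form (g i) & h = eval g f]).

Local Notation x1 := (gen 0%N : FX).
Local Notation x2 := (gen 1%N : FX).
Local Notation x3 := (gen 2%N : FX).
Local Notation x4 := (gen 3%N : FX).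

Definition Gamma3 : FX := lie (lie x1 x2) x3.

Definition St3 : FX := x1 * lie x2 x3 - x2 * lie x1 x3 + x3 * lie x1 x2.

Definition T4 : FX :=
  lie x1 x2 * lie x3 x4 - lie x1 x3 * lie x2 x4 + lie x2 x3 * lie x1 x4.

End WeakIdentities.

Arguments Gamma3 {F}.
Arguments St3 {F}.
Arguments T4 {F}.

(* Main.v *)
Require Import Defs.
From HB Require Import structures.
From mathcomp Require Import all_boot all_algebra.
From mathcomp Require Import finmap monalg.
From mathcomp Require Import boolp classical_sets functions cardinality.
From mathcomp Require Import zify ring.

(** Write c_ij for [x_i, x_j] and J for the two-sided ideal generated by the
    instances of Gamma3, St3 and T4 at letters; J is contained in the L-ideal.
    The proof shows that the elements of J are the only weak identities of
    degree at most 4, by matching an upper and a lower bound.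

    Reduction to one content.  Replacing the value of one letter by t times
    it multiplies a word by t to the number of occurrences of that letter.
    The field is infinite, so the Vandermonde determinant separates these
    powers, and the part of a weak identity supported on the words with a given
    multiset of letters is again a weak identity ([content_component]).

    Spanning.  Modulo J the c_ij are central, and St3 reads
    x_i c_jk = c_ik x_j - c_ij x_k.  So once one letter i is singled out, any
    commutator standing next to x_i can be traded for commutators that involve
    i: every word with letters i, s is a combination of the word i s and of
    products c_ij w with j taken from s ([span_leading_forms]).  Repeating this
    on w gives the explicit spanning list [normal_forms]; for four letters it is
      ijkl, c_ij kl, c_ij c_kl, c_ik jl, c_ik c_jl, c_il jk, c_il c_jk,
    and T4 makes one of the last products superfluous.  This is the first step
    of the straightening law for minors: x_i and c_ij behave like the minors
    [i *] and [i j] of a matrix with two rows.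

    Independence.  A combination of these elements that vanishes in the Weyl
    algebra is evaluated at points where each letter is x, y or x + y, chosen
    so that most of the terms are zero ([normal_form_deg2],
    [normal_form_deg3], [normal_form_deg4]).  What has to be known about the
    Weyl algebra is that [y, x] = 1 and that no power of x is zero
    ([weyl_xX_neq0]).  When letters coincide some terms vanish and others become
    equal, and the evaluations then give exactly the vanishing of the sums of
    coefficients that remain. *)

Set Implicit Arguments.
Unset Strict Implicit.
Unset Printing Implicit Defensive.

Import GRing.Theory.
Local Open Scope ring_scope.

(** * Separation of powers over an infinite field *)

Section Vandermonde.
Variables (F : fieldType) (V : lmodType F).

Lemma infinite_field_inj :
  infinite_set [set: F]%classic -> exists t : nat -> F, injective t.
Proof.
move=> /infiniteP/card_leP[t].
  exists (fun n => val (t (exist _ n (mem_setT n)))) => p q /val_inj.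
by move=> /inj-/(_ (mem_setT _) (mem_setT _))[].
Qed.

(** A polynomial with coefficients in a vector space that vanishes on an
    infinite field is zero: the inverse of a Vandermonde matrix at distinct
    scalars recovers the coefficients from the values. *)
Lemma vanishing_coefs (n : nat) (u : 'I_n -> V) :
    infinite_set [set: F]%classic ->
    (forall t : F, \sum_(d < n) t ^+ d *: u d = 0) ->
  forall d, u d = 0.
Proof.
move=> /infinite_field_inj[t tI] u0 d.
pose T : 'M[F]_n := Vandermonde n (\row_k t k).
have uT : T \in unitmx.
  rewrite unitmxE unitfE det_Vandermonde; apply/prodf_neq0 => i _.
  apply/prodf_neq0 => j ltij; rewrite !mxE subr_eq0 (inj_eq tI).
  by rewrite gtn_eqF.
transitivity (\sum_k invmx T k d *: (\sum_(e < n) t k ^+ e *: u e)); last first.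
  by rewrite big1 // => k _; rewrite u0 scaler0.
under eq_bigr => k _ do rewrite scaler_sumr.
rewrite exchange_big /= -[LHS]scale1r.
have E (e : 'I_n) : \sum_k invmx T k d *: (t k ^+ e *: u e) = (e == d)%:R *: u e.
  under eq_bigr => k _ do rewrite scalerA mulrC.
  rewrite -scaler_suml; congr (_ *: _).
  have /matrixP/(_ e d) := mulmxV uT; rewrite !mxE => <-.
  by apply: eq_bigr => k _; rewrite !mxE.
rewrite (bigD1 d) //= E eqxx big1 ?addr0 // => e /negPf ned.
by rewrite E ned scale0r.
Qed.

End Vandermonde.

(** * Words and multihomogeneous components *)

Section Words.
Variable F : fieldType.
Local Notation FX := (freeAlg F nat).

Definition word (w : seq nat) : FX := \prod_(p <- w) gen p.

Lemma word_cons p w : word (p :: w) = gen p * word w.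
Proof. by rewrite /word big_cons. Qed.

Lemma eval_word (A : algType F) (v : nat -> A) w :
  eval v (word w) = \prod_(p <- w) v p.
Proof. by rewrite rmorph_prod; apply: eq_bigr => p _; exact: eval_gen. Qed.

Lemma wordE (m : {fmonom nat}) : word m = << m >> :> FX.
Proof.
case: m => m; elim: m => [|p m IH].
  rewrite /word big_nil; congr (<< _ >>); apply: val_inj => /=.
  by rewrite fm1.
rewrite /= word_cons -/(word (FMonom m)) IH /gen.
have -> : FMonom (p :: m) = mmul (fmu p) (FMonom m).
  by apply: val_inj; rewrite /= fmM fmU.
by rewrite -[RHS]/(<< 1 *g _ >>) -[in RHS](mulr1 1) -fgmulUU.
Qed.

Lemma sum_words (f : FX) :
  f = \sum_(w <- [seq (m : seq nat) | m : {fmonom nat} <- msupp f])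
        f@_(FMonom w) *: word w.
Proof.
rewrite big_map [LHS](monalgE (f : {malg F[{fmonom nat}]})).
apply: eq_bigr => m _; rewrite wordE -[m in RHS]/m.
have -> : FMonom m = m by case: m.
by apply/malgP => k; rewrite mcoeffZ !mcoeffU mulr_natr.
Qed.

Definition lincomb (a : seq nat -> F) (r : seq (seq nat)) : FX :=
  \sum_(w <- r) a w *: word w.

Lemma eval_lincomb (A : algType F) (v : nat -> A) a r :
  eval v (lincomb a r) = \sum_(w <- r) a w *: eval v (word w).
Proof. by rewrite raddf_sum; apply: eq_bigr => w _; exact: linearZ. Qed.

Variables (A : algType F) (V : A -> Prop).
Hypothesis VZ : forall t v, V v -> V (t *: v).
Hypothesis F_infinite : infinite_set [set: F]%classic.

(** Scaling the value of the letter [p] by [t] turns the identity into a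
    polynomial in [t] whose coefficients are the values of its components. *)
Lemma count_component a r (p d : nat) : weak_identity V (lincomb a r) ->
  weak_identity V (lincomb a [seq w <- r | count_mem p w == d]).
Proof.
move=> id_r v Vv.
pose n := (maxn d (\max_(w <- r) count_mem p w)).+1.
pose u (e : 'I_n) := eval v (lincomb a [seq w <- r | count_mem p w == e]).
suff : forall e, u e = 0.
  by move=> /(_ (Ordinal (leq_maxl d _ : (d < n)%N))).
apply: vanishing_coefs => // t.
pose vt q := if q == p then t *: v q else v q.
have Vvt q : V (vt q) by rewrite /vt; case: ifP => // _; apply: VZ.
have vt_word w : eval vt (word w) = t ^+ count_mem p w *: eval v (word w).
  rewrite !eval_word; elim: w => [|q w IH]; first by rewrite !big_nil scale1r.
  rewrite !big_cons IH /= /vt; case: eqP => [->|_] /=.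
    by rewrite add1n -scalerAl -scalerAr scalerA exprS.
  by rewrite -scalerAr.
rewrite -[RHS](id_r _ Vvt) eval_lincomb.
under eq_bigr => e _ do rewrite /u eval_lincomb big_filter scaler_sumr big_mkcond.
rewrite exchange_big /=; apply: eq_big_seq => w wr.
have ltw : (count_mem p w < n)%N.
  rewrite ltnS leq_max; apply/orP; right.
  exact: (@leq_bigmax_seq _ r xpredT (fun w => count_mem p w)).
rewrite -big_mkcond (big_pred1 (Ordinal ltw)) => [|e] /=; last first.
  by rewrite -val_eqE eq_sym.
by rewrite vt_word !scalerA mulrC.
Qed.

Lemma content_component a r s : weak_identity V (lincomb a r) ->
  weak_identity V (lincomb a [seq w <- r | perm_eq s w]).
Proof.
move=> id_r.
(* Letters absent from both s and r impose no condition, so it is enough to fix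
   the multiplicities of the letters of s ++ flatten r, one at a time. *)
pose same L w := all (fun p => count_mem p w == count_mem p s) L.
have id_same L : weak_identity V (lincomb a [seq w <- r | same L w]).
  elim: L => [|p L IH]; first by rewrite (eq_filter (a2 := predT)) ?filter_predT.
  by rewrite -/(filter _ _) /= filter_predI; apply: count_component.
rewrite (_ : [seq w <- r | _] = [seq w <- r | same (s ++ flatten r) w]) //.
apply: eq_in_filter => w wr; apply/idP/allP => [/permP eq_sw p _|same_w].
  by rewrite eq_sw.
apply/allP => p; rewrite mem_cat /= eq_sym => ps; apply: same_w.
rewrite mem_cat; case/orP: ps => [->//|pw]; apply/orP; right.
by apply/flattenP; exists w.
Qed.

(** Splitting off the component of the first word leaves a weak identity with
    fewer words, whence an induction principle: to prove an additive property
    of a weak identity, it is enough to treat those of a single content. *)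
Lemma multihomogeneous_ind (J : FX -> Prop) a r :
    J 0 -> (forall g h, J g -> J h -> J (g + h)) ->
    (forall s r', s \in r -> {in r', forall w, perm_eq s w} ->
       weak_identity V (lincomb a r') -> J (lincomb a r')) ->
  weak_identity V (lincomb a r) -> J (lincomb a r).
Proof.
move=> J0 JD; have [n] := ubnP (size r).
elim: n r => // n IH [|s r] ltr Jhom id_r; first by rewrite /lincomb big_nil.
set r1 := [seq w <- s :: r | perm_eq s w].
set r2 := [seq w <- s :: r | ~~ perm_eq s w].
have id1 : weak_identity V (lincomb a r1) by apply: content_component.
have E : lincomb a (s :: r) = lincomb a r1 + lincomb a r2.
  by rewrite /lincomb /r1 /r2 !big_filter [LHS](bigID (perm_eq s)).
have sub2 : {subset r2 <= s :: r} by move=> w; rewrite mem_filter => /andP[].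
rewrite E; apply: JD.
  apply: (Jhom s) => // [|w]; first exact: mem_head.
  by rewrite mem_filter => /andP[].
apply: IH => [|t r' tr2 eq_t id'|v Vv].
- apply: leq_ltn_trans (_ : size r < n)%N; last exact: ltr.
  by rewrite /r2 /= perm_refl /= size_filter count_size.
- by apply: (Jhom t) => //; apply: sub2.
- by have := id_r v Vv; rewrite E raddfD /= id1 // add0r.
Qed.

End Words.

(** * The three relations in an arbitrary ring *)

Section Relations.
Variable R : nzRingType.
Implicit Types a b c d u : R.

Definition st3 a b c := a * lie b c - b * lie a c + c * lie a b.

Definition t4 a b c d :=
  lie a b * lie c d - lie a c * lie b d + lie b c * lie a d.

Lemma lie_diag a : lie a a = 0.
Proof. exact: subrr. Qed.

Lemma lieC a b : lie a b = - lie b a.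
Proof. by rewrite /lie opprB. Qed.

Lemma lieMr a b c : lie a (b * c) = lie a b * c + b * lie a c.
Proof. by rewrite /lie mulrBl mulrBr !mulrA addrA subrK. Qed.

Lemma mulrCA_lie a b u : a * (b * u) = b * (a * u) - lie b a * u.
Proof. by rewrite /lie mulrBl !mulrA subKr. Qed.

(** The exchange behind the reduction to normal form: when double commutators
    and St3 vanish, [a * lie b c] becomes a combination of multiples of
    commutators that involve [a]. *)
Lemma st3_mulr a b c u :
  a * (lie b c * u) - (lie a c * (b * u) - lie a b * (c * u)) =
  st3 a b c * u - lie (lie a c) b * u + lie (lie a b) c * u.
Proof.
rewrite /st3 [lie (lie a c) b]/lie [lie (lie a b) c]/lie.
rewrite !mulrA -!mulrBl -mulrDl; congr (_ * u).
rewrite opprB [in RHS]opprB (addrACA _ (c * lie a b)) subrK -addrA; congr (_ + _).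
by rewrite addrC addrA subrK.
Qed.

(** T4 multiplies two of its commutators in the order opposite to that of the
    normal forms; the correction is a commutator of commutators. *)
Lemma t4_exchange a b c d :
  lie a b * lie c d - lie a c * lie b d + lie a d * lie b c =
  t4 a b c d - lie (lie b c) (lie a d).
Proof.
by rewrite /t4 [lie (lie b c) _]/lie opprB [RHS]addrA (addrAC (_ - _)) addrK.
Qed.

End Relations.

Section RmorphRelations.
Variables (R S : nzRingType) (phi : {rmorphism R -> S}).

Lemma rmorph_lie a b : phi (lie a b) = lie (phi a) (phi b).
Proof. by rewrite /lie rmorphB !rmorphM. Qed.

Lemma rmorph_st3 a b c : phi (st3 a b c) = st3 (phi a) (phi b) (phi c).
Proof. by rewrite /st3 rmorphD rmorphB !rmorphM !rmorph_lie. Qed.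

Lemma rmorph_t4 a b c d : phi (t4 a b c d) = t4 (phi a) (phi b) (phi c) (phi d).
Proof. by rewrite /t4 rmorphD rmorphB !rmorphM !rmorph_lie. Qed.

End RmorphRelations.

(** * Spans modulo a left ideal *)

Section SpanModulo.
Variables (F : fieldType) (A : algType F).
Implicit Types (B : seq A) (u v : A).

Definition left_ideal (J : {pred A}) := [/\ 0 \in J,
  {in J &, forall u v, u + v \in J} & forall a, {in J, forall u, a * u \in J}].

(** Recursion on the list yields the coefficients one existential quantifier at
    a time, so no family of scalars indexed by the list has to be carried
    along in the closure properties. *)
Fixpoint span_mod (J : {pred A}) B u : Prop :=
  if B is b :: B' then exists t : F, span_mod J B' (u - t *: b) else u \in J.

Variable J : {pred A}.
Hypothesis J_left : left_ideal J.

Let J0 : 0 \in J. Proof. by case: J_left. Qed.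
Let JD u v : u \in J -> v \in J -> u + v \in J.
Proof. by case: J_left => _ JD _; apply: JD. Qed.
Let JM a u : u \in J -> a * u \in J.
Proof. by case: J_left => _ _; apply. Qed.

Lemma span_mod_congr B u v : u - v \in J -> span_mod J B v -> span_mod J B u.
Proof.
elim: B u v => [|b B IH] u v Juv /= => [Jv|[t Bv]].
  by rewrite -(subrK v u); apply: JD.
by exists t; apply: IH Bv; rewrite opprB addrA subrK.
Qed.

Lemma span_mod_lin B t u v :
  span_mod J B u -> span_mod J B v -> span_mod J B (t *: u + v).
Proof.
elim: B u v => [|b B IH] u v /= => [Ju Jv|[p Bu] [q Bv]].
  by apply: JD => //; rewrite -mulr_algl; apply: JM.
exists (t * p + q).
by rewrite scalerDl -scalerA opprD addrACA -scalerBr; apply: IH.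
Qed.

Lemma span_mod_ideal B u : u \in J -> span_mod J B u.
Proof.
by elim: B => // b B IH Ju /=; exists 0; rewrite scale0r subr0; apply: IH.
Qed.

Lemma span_mod_mem B b : b \in B -> span_mod J B b.
Proof.
elim: B => // b' B IH; rewrite inE => /predU1P[<-|bB].
  by exists 1; rewrite scale1r subrr; apply: span_mod_ideal.
by exists 0; rewrite scale0r subr0; apply: IH.
Qed.

Lemma span_mod_mull B B' z u : span_mod J B u ->
  (forall b, b \in B -> span_mod J B' (z * b)) -> span_mod J B' (z * u).
Proof.
elim: B u => [|b B IH] u /= => [Ju _|[t Bu] BB'].
  by apply/span_mod_ideal/JM.
rewrite -(subrK (t *: b) u) addrC mulrDr -scalerAr.
apply: span_mod_lin; first by apply: BB'; rewrite mem_head.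
by apply: IH => // b' b'B; apply: BB'; rewrite inE b'B orbT.
Qed.

Lemma span_modB B u v :
  span_mod J B u -> span_mod J B v -> span_mod J B (u - v).
Proof. by move=> Bu Bv; rewrite addrC -scaleN1r; apply: span_mod_lin. Qed.

Lemma span_mod_sum B (I : eqType) (r : seq I) (t : I -> F) (g : I -> A) :
    (forall i, i \in r -> span_mod J B (g i)) ->
  span_mod J B (\sum_(i <- r) t i *: g i).
Proof.
elim: r => [|i r IH] Bg; first by rewrite big_nil; apply: span_mod_ideal.
rewrite big_cons; apply: span_mod_lin; first by apply: Bg; rewrite mem_head.
by apply: IH => j jr; apply: Bg; rewrite inE jr orbT.
Qed.

Lemma span_modP B u : span_mod J B u ->
  exists2 t : seq F, size t = size B & u - \sum_(p <- zip t B) p.1 *: p.2 \in J.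
Proof.
elim: B u => [|b B IH] u /= => [Ju|[c /IH[t szt Ju]]].
  by exists [::]; rewrite ?big_nil ?subr0.
by exists (c :: t); rewrite /= ?szt // big_cons opprD addrA.
Qed.

End SpanModulo.

(** * Normal forms *)

Lemma perm_swap (T : eqType) (p q : T) s t :
  perm_eq (p :: q :: s) t = perm_eq (q :: p :: s) t.
Proof.
have /permPl -> // : perm_eq (p :: q :: s) (q :: p :: s).
by apply/permP => a /=; rewrite addnCA.
Qed.

(** Selecting a position rather than a letter keeps the list explicit when the
    letters are variables: no test of equality between letters is made. *)
Fixpoint select (s : seq nat) : seq (nat * seq nat) :=
  if s is i :: s' then (i, s') :: [seq (p.1, i :: p.2) | p <- select s'] else [::].

Lemma select_perm s p : p \in select s -> perm_eq (p.1 :: p.2) s.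
Proof.
elim: s p => // i s IH p; rewrite inE => /predU1P[->//|/mapP[q /IH eqs ->]] /=.
by rewrite perm_swap perm_cons.
Qed.

Lemma select_mem s j : j \in s -> exists2 p, p \in select s & p.1 = j.
Proof.
elim: s => // i s IH; rewrite inE => /predU1P[->|/IH[p ps <-]].
  by exists (i, s); rewrite ?mem_head.
exists (p.1, i :: p.2) => //; rewrite inE; apply/orP; right.
by apply/mapP; exists p.
Qed.

(** The spanning list of words with content [s], with [i] the first letter of
    [s] and [n] an upper bound on the number of rounds; every round removes two
    letters, so [n := size s] is ample.  The ring and the values of the letters
    are parameters because the same list is needed in the free algebra, where it
    spans, and in the Weyl algebra, where it is evaluated. *)
Fixpoint normal_forms (R : nzRingType) (v : nat -> R) (n : nat) (s : seq nat) :
    seq R :=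
  \prod_(p <- s) v p :: (if n isn't n'.+1 then [::] else
    if s isn't i :: s' then [::] else
    flatten [seq [seq lie (v i) (v p.1) * b | b <- normal_forms v n' p.2]
            | p <- select s']).

Lemma map_normal_forms (R S : nzRingType) (phi : {rmorphism R -> S}) v n s :
  [seq phi b | b <- normal_forms v n s] = normal_forms (phi \o v) n s.
Proof.
elim: n s => [|n IH] [|i s] /=; rewrite rmorph_prod //.
congr (_ :: _); rewrite map_flatten -map_comp; congr flatten.
apply: eq_map => p /=; rewrite -IH -!map_comp; apply: eq_map => b /=.
by rewrite rmorphM rmorph_lie.
Qed.

(** * Reduction to normal form in the free algebra *)

Section LetterIdeal.
Variable F : fieldType.
Local Notation FX := (freeAlg F nat).
Local Notation word := (@word F).

Definition comm (i j : nat) : FX := lie (gen i) (gen j).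

(** Instances at letters suffice for the reduction, and unlike instances at
    linear forms they are evaluated directly. *)
Variant letter_rel : FX -> Prop :=
| Gamma3_rel i j k : letter_rel (lie (comm i j) (gen k))
| St3_rel i j k : letter_rel (st3 (gen i) (gen j) (gen k))
| T4_rel i j k l : letter_rel (t4 (gen i) (gen j) (gen k) (gen l)).

Definition letter_ideal : {pred FX} :=
  [pred u | `[< ideal_gen letter_rel u >]].
Local Notation J := letter_ideal.

HB.instance Definition _ := GRing.isZmodClosed.Build FX letter_ideal
  (ideal_gen_zmod letter_rel).

Lemma letter_idealM a b u : u \in J -> a * u * b \in J.
Proof. by move=> /asboolP Ju; apply/asboolP; apply: ideal_genM. Qed.

Lemma letter_idealMl a u : u \in J -> a * u \in J.
Proof. by rewrite -[X in _ -> X \in _]mulr1; apply: letter_idealM. Qed.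

Lemma letter_idealMr b u : u \in J -> u * b \in J.
Proof. by rewrite -[X in _ -> X * _ \in _]mul1r; apply: letter_idealM. Qed.

Lemma letter_idealZ t u : u \in J -> t *: u \in J.
Proof. by rewrite -mulr_algl; apply: letter_idealMl. Qed.

Lemma letter_rel_in u : letter_rel u -> u \in J.
Proof.
move=> Su; apply/asboolP; exists [:: (1, u, 1)]; last first.
  by rewrite big_seq1 mul1r mulr1.
by move=> t; rewrite inE => /eqP ->.
Qed.

Lemma linear_form_gen i : linear_form (gen i : FX).
Proof.
exists i.+1, (fun j => (j == i)%:R).
rewrite (bigD1 ord_max) //= eqxx scale1r big1 ?addr0 // => j.
by rewrite -val_eqE /= => /negPf ->; rewrite scale0r.
Qed.

Section EvalRelations.
Variables (A : algType F) (v : nat -> A).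

Lemma eval_Gamma3 : eval v Gamma3 = lie (lie (v 0%N) (v 1%N)) (v 2%N).
Proof. by rewrite /Gamma3 !(rmorph_lie (eval v)) /= !eval_gen. Qed.

Lemma eval_St3 : eval v St3 = st3 (v 0%N) (v 1%N) (v 2%N).
Proof. by rewrite -!(eval_gen v); exact: (rmorph_st3 (eval v)). Qed.

Lemma eval_T4 : eval v T4 = t4 (v 0%N) (v 1%N) (v 2%N) (v 3%N).
Proof. by rewrite -!(eval_gen v); exact: (rmorph_t4 (eval v)). Qed.

End EvalRelations.

Lemma letter_ideal_L_ideal u : u \in J -> L_ideal [:: Gamma3; St3; T4] u.
Proof.
move=> /asboolP[r Sr ->]; exists r => // t /Sr.
have letters s p : linear_form (gen (nth 0%N s p) : FX).
  exact: linear_form_gen.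
case=> [i j k|i j k|i j k l].
- exists Gamma3, (fun n => gen (nth 0%N [:: i; j; k] n)); split=> [|p|].
  + exact: mem_head.
  + exact: letters.
  + by symmetry; apply: eval_Gamma3.
- exists St3, (fun n => gen (nth 0%N [:: i; j; k] n)); split=> [|p|].
  + by rewrite in_cons mem_head orbT.
  + exact: letters.
  + by symmetry; apply: eval_St3.
- exists T4, (fun n => gen (nth 0%N [:: i; j; k; l] n)); split=> [|p|].
  + exact: (mem_last Gamma3 [:: St3; T4]).
  + exact: letters.
  + by symmetry; apply: eval_T4.
Qed.

(** Gamma3 makes the commutators commute with letters, hence with words. *)
Lemma comm_central i j u : lie (comm i j) u \in J.
Proof.
rewrite (sum_words u) /lie mulr_sumr mulr_suml -sumrB; apply: rpred_sum => w _.
rewrite -scalerAr -scalerAl -scalerBr; apply: letter_idealZ.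
elim: w {u} => [|k w IH]; first by rewrite /word big_nil mulr1 mul1r subrr rpred0.
rewrite word_cons.
rewrite [X in X \in _](lieMr (comm i j) (gen k) (word w)).
apply: rpredD; last exact: letter_idealMl.
by apply/letter_idealMr/letter_rel_in/Gamma3_rel.
Qed.

Lemma comm_exchange i j k u :
  gen i * (comm j k * u) - (comm i k * (gen j * u) - comm i j * (gen k * u)) \in J.
Proof.
rewrite [X in X \in _](st3_mulr (gen i) (gen j) (gen k) u).
apply: rpredD; first apply: rpredB.
- exact/letter_idealMr/letter_rel_in/St3_rel.
- exact/letter_idealMr/letter_rel_in/Gamma3_rel.
- exact/letter_idealMr/letter_rel_in/Gamma3_rel.
Qed.

Local Notation spanJ := (span_mod letter_ideal).

Lemma letter_ideal_left : left_ideal letter_ideal.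
Proof.
split; [exact: rpred0 | exact: rpredD | exact: letter_idealMl].
Qed.

(** One round of the reduction: the commutators all involve [i], while the words
    they multiply are still in arbitrary order. *)
Definition leading_forms (i : nat) (s : seq nat) : seq FX :=
  word (i :: s) ::
    pmap (fun t => if t is j :: w then Some (comm i j * word w) else None)
      (permutations s).

Lemma leading_forms_word i s : spanJ (leading_forms i s) (word (i :: s)).
Proof. by apply: (span_mod_mem letter_ideal_left); apply: mem_head. Qed.

Lemma leading_forms_comm i j w s :
  perm_eq (j :: w) s -> spanJ (leading_forms i s) (comm i j * word w).
Proof.
move=> eq_s; apply: (span_mod_mem letter_ideal_left).
rewrite in_cons mem_pmap; apply/orP; right.
by apply/mapP; exists (j :: w); rewrite ?mem_permutations.
Qed.

Lemma leading_formsP i s b : b \in leading_forms i s ->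
  b = word (i :: s) \/
  exists j w, perm_eq (j :: w) s /\ b = comm i j * word w.
Proof.
rewrite in_cons; case/predU1P=> [->|]; first by left.
rewrite mem_pmap => /mapP[[|j w]]; rewrite mem_permutations // => eq_s [->].
by right; exists j, w.
Qed.

(** By induction on the number of letters, applied to the word without its first
    letter [a].  If [a] is [i], the remaining word is reduced with respect to
    some letter [j], and [comm_exchange] turns x_i c_jk into terms with c_ik and
    c_ij.  If not, the remaining word is reduced with respect to [i], and x_a is
    moved past x_i or past the commutator at the cost of c_ai or of an element
    of the ideal. *)
Lemma span_leading_forms i s w :
  perm_eq w (i :: s) -> spanJ (leading_forms i s) (word w).
Proof.
have Jl := letter_ideal_left.
have [n] := ubnP (size s); elim: n i s w => // n IH i s w; rewrite ltnS => les eqw.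
have start w' : perm_eq w' s -> spanJ (leading_forms i s) (gen i * word w').
  case: s les {eqw} => [_ /perm_nilP->|j s les eqw'].
    by rewrite -word_cons; apply: leading_forms_word.
  apply: (span_mod_mull Jl (IH j s w' les eqw')) => b.
  case/leading_formsP=> [->|[k [t [eqt ->]]]].
    by rewrite -word_cons; apply: leading_forms_word.
  apply: (span_mod_congr Jl (comm_exchange i j k (word t))).
  rewrite -!word_cons; apply: (span_modB Jl); apply: leading_forms_comm.
    by rewrite perm_swap perm_cons.
  by rewrite perm_cons.
case: w eqw => [|a w] eqw; first by have := perm_size eqw.
rewrite word_cons; have [eqai|neai] := eqVneq a i.
  by rewrite eqai in eqw *; apply: start; rewrite perm_cons in eqw.
have as_ : a \in s.
  by have := perm_mem eqw a; rewrite mem_head inE (negPf neai) => /esym.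
have eq_as := perm_to_rem as_; set s' := rem a s in eq_as.
have eqw' : perm_eq w (i :: s').
  rewrite -(perm_cons a) perm_sym perm_swap perm_sym (permPl eqw) perm_cons.
  exact: eq_as.
have les' : (size s' < n)%N by rewrite (perm_size eq_as) in les.
apply: (span_mod_mull Jl (IH i s' w les' eqw')) => b.
case/leading_formsP=> [->|[k [t [eqt ->]]]].
  rewrite word_cons [X in spanJ _ X](mulrCA_lie (gen a) (gen i) (word s')).
  apply: (span_modB Jl).
    by rewrite -word_cons; apply: start; rewrite perm_sym.
  by apply: leading_forms_comm; rewrite perm_sym.
rewrite [X in spanJ _ X](mulrCA_lie (gen a) (comm i k) (word t)) -word_cons.
apply: (span_modB Jl).
  apply: leading_forms_comm; rewrite perm_swap perm_sym (permPl eq_as) perm_cons.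
  by rewrite perm_sym.
by apply/span_mod_ideal/letter_idealMr/letter_rel_in/Gamma3_rel.
Qed.

Lemma span_normal_forms n s w : (size s <= n)%N ->
  perm_eq w s -> spanJ (normal_forms gen n s) (word w).
Proof.
have Jl := letter_ideal_left.
elim: n s w => [|n IH] [|i s] w // les eqw.
- by apply: (span_mod_mem Jl); rewrite (perm_nilP eqw) mem_head.
- by apply: (span_mod_mem Jl); rewrite (perm_nilP eqw) mem_head.
rewrite -[word w]mul1r; apply: (span_mod_mull Jl (span_leading_forms eqw)) => b.
rewrite mul1r => /leading_formsP[->|[j [t [eqt ->]]]].
  by apply: (span_mod_mem Jl); rewrite mem_head.
have js : j \in s by rewrite -(perm_mem eqt) mem_head.
have [p ps pj] := select_mem js; have eqp := select_perm ps; rewrite pj in eqp.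
have eqtp : perm_eq t p.2 by rewrite -(perm_cons j) (permPl eqt) perm_sym.
have lep : (size p.2 <= n)%N.
  by rewrite /= ltnS -(perm_size eqp) in les; apply: ltnW.
apply: (span_mod_mull Jl (IH p.2 t lep eqtp)) => b' b'p.
apply: (span_mod_mem Jl); rewrite in_cons; apply/orP; right.
apply/flattenP; exists [seq comm i p.1 * b | b <- normal_forms gen n p.2].
  by apply/mapP; exists p.
by apply/mapP; exists b'; rewrite ?pj.
Qed.

End LetterIdeal.

(** * Powers of x in the Weyl algebra *)

Section WeylPowers.
Variable F : fieldType.

Lemma weyl_ideal_eval (A : algType F) (v : bool -> A) u :
  lie (v true) (v false) = 1 -> u \in @weyl_ideal F -> eval v u = 0.
Proof.
move=> v1 /asboolP[r Sr ->]; rewrite raddf_sum big_seq big1 // => t /Sr /= <-.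
have -> : eval v (t.1.1 * @weyl_rel F * t.2) =
    eval v t.1.1 * eval v (@weyl_rel F) * eval v t.2.
  exact: etrans (rmorphM _ _ _) (congr1 ( *%R^~ _) (rmorphM _ _ _)).
suff -> : eval v (@weyl_rel F) = 0 by rewrite mulr0 mul0r.
have -> : eval v (@weyl_rel F) = lie (eval v (gen true)) (eval v (gen false)) - 1.
  rewrite /weyl_rel; etransitivity; first exact: rmorphB.
  by congr (_ - _); [exact: rmorph_lie | exact: rmorph1].
by rewrite !eval_gen v1 subrr.
Qed.

Lemma weyl_pi0 : weyl_pi (0 : freeAlg F bool) = 0.
Proof. by rewrite -[0 in LHS](scale0r 1) weyl_piZ scale0r. Qed.

Lemma weyl_piX (u : freeAlg F bool) n : weyl_pi (u ^+ n) = weyl_pi u ^+ n.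
Proof.
by elim: n => [|n IH]; rewrite ?expr0 ?weyl_pi1 // !exprS weyl_piM IH.
Qed.

(** The substitution of x - 1 for x respects the relation yx - xy = 1, so
    x ^+ n = 0 would force (x - 1) ^+ n = 0; but x nilpotent makes x - 1
    invertible.  In characteristic p the action on polynomials by multiplication
    and differentiation is not faithful, whereas this argument is uniform. *)
Lemma weyl_xX_neq0 n : weyl_x F ^+ n != 0.
Proof.
apply/eqP => x0; set x := weyl_x F in x0.
have x10 : (x - 1) ^+ n = 0.
  pose v b := if b then weyl_y F else x - 1.
  have v1 : lie (v true) (v false) = 1.
    rewrite /lie /= mulrBr mulrBl mulr1 mul1r opprB addrA subrK.
    exact: weyl_yx.
  have <- : eval v (gen false ^+ n) = (x - 1) ^+ n.
    by rewrite (rmorphXn (eval v)) /= eval_gen.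
  apply: weyl_ideal_eval v1 _; rewrite -[_ ^+ _]subr0; apply/weyl_pi_eq.
  by rewrite weyl_piX weyl_pi0.
(* x ^+ n = 0 gives -1 = (x - 1) * (sum of powers of x), two commuting factors;
   the n-th power of this equation reads (-1) ^+ n = 0. *)
have /eqP := congr1 (fun u => u ^+ n) (subrX1 x n).
rewrite x0 sub0r exprMn_comm ?x10 ?mul0r ?signr_eq0 //.
apply: commr_sum => i _; apply: commrX.
by apply: commr_sym; apply: commrB; [exact: commr_refl | exact: commr1].
Qed.

End WeylPowers.

(** * Evaluation at points of the plane spanned by x and y *)

Section Plane.
Variables (F : fieldType) (A : algType F) (x y : A).
Hypothesis lie_yx : lie y x = 1.

(** The commutator of two points is the scalar given by a 2 x 2 minor of their
    coordinates, so St3 and T4 hold as the relations between minors of a matrix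
    with two rows. *)
Definition plane_point (a b : nat -> F) (p : nat) : A := a p *: x + b p *: y.
Definition minor (a b : nat -> F) (p q : nat) : F := b p * a q - a p * b q.

Lemma lie_plane a b c d :
  lie (a *: x + b *: y) (c *: x + d *: y) = (b * c - a * d)%:A.
Proof.
have lieD (u v w z : A) :
    lie (u + v) (w + z) = lie u w + lie u z + (lie v w + lie v z).
  rewrite /lie !mulrDl !mulrDr (addrACA (w * u)) !opprD.
  by rewrite [LHS]addrACA; congr (_ + _); rewrite addrACA.
have lieZ (p q : F) (u v : A) : lie (p *: u) (q *: v) = (p * q) *: lie u v.
  by rewrite /lie -!scalerAl -!scalerAr !scalerA scalerBr [q * p]mulrC.
rewrite lieD !lieZ lie_yx (lieC x y) lie_yx /lie !subrr !scaler0 add0r addr0.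
by rewrite scalerN addrC -scalerBl.
Qed.

Lemma lie_plane_point a b p q :
  lie (plane_point a b p) (plane_point a b q) = (minor a b p q)%:A.
Proof. exact: lie_plane. Qed.

Lemma st3_plane_point a b i j k :
  st3 (plane_point a b i) (plane_point a b j) (plane_point a b k) = 0.
Proof.
rewrite /st3 !lie_plane_point -!scalerAr !mulr1 /plane_point.
rewrite !scalerDr !scalerA opprD [X in X + _ = _]addrACA -!scalerBl addrACA.
rewrite -!scalerDl [X in X *: x](_ : _ = 0); last by rewrite /minor; ring.
by rewrite [X in X *: y](_ : _ = 0) ?scale0r ?addr0 // /minor; ring.
Qed.

Lemma t4_plane_point a b i j k l :
  t4 (plane_point a b i) (plane_point a b j)
     (plane_point a b k) (plane_point a b l) = 0.
Proof.
rewrite /t4 !lie_plane_point !mulr_algl !scalerA -scalerBl -scalerDl.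
by rewrite (_ : _ - _ + _ = 0) ?scale0r // /minor; ring.
Qed.

Lemma letter_ideal_eval0 a b u :
  u \in @letter_ideal F -> eval (plane_point a b) u = 0.
Proof.
move=> /asboolP[r Sr ->]; rewrite raddf_sum big_seq big1 // => -[[f g] h] /Sr /= rel.
have -> : eval (plane_point a b) (f * g * h) =
    eval (plane_point a b) f * eval (plane_point a b) g * eval (plane_point a b) h.
  exact: etrans (rmorphM _ _ _) (congr1 ( *%R^~ _) (rmorphM _ _ _)).
suff -> : eval (plane_point a b) g = 0 by rewrite mulr0 mul0r.
case: g / rel => [i j k|i j k|i j k l].
- rewrite !(rmorph_lie (eval (plane_point a b))) /= !eval_gen lie_plane_point.
  by rewrite /lie mulr_algl mulr_algr subrr.
- by rewrite (rmorph_st3 (eval (plane_point a b))) /= !eval_gen st3_plane_point.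
- by rewrite (rmorph_t4 (eval (plane_point a b))) /= !eval_gen t4_plane_point.
Qed.

Hypothesis xX_neq0 : forall n, x ^+ n != 0.

(** * Independence of the normal forms *)

Lemma scale_xX_eq0 t n : t *: x ^+ n = 0 -> t = 0.
Proof. by move/eqP; rewrite scaler_eq0 (negPf (xX_neq0 n)) orbF => /eqP. Qed.

(* The coordinates of the points used below are 0 or 1 according to tests on
   letters, which the order of the letters decides. *)
Ltac decide_letters := repeat match goal with
  | |- context [@eq_op _ ?p ?q] =>
     first [rewrite (_ : (p == q) = false); last by lia
           |rewrite (_ : (p == q) = true); last by lia]
  | |- context [leq ?p ?q] =>
     first [rewrite (_ : leq p q = false); last by lia
           |rewrite (_ : leq p q = true); last by lia] end.

Ltac clean := rewrite ?(mul1r, mulr1, mulr0, mul0r, subr0, sub0r, subrr,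
  scale0r, scale1r, addr0, add0r, mulrN1, mulN1r, oppr0, opprK).

Ltac at_point H a b :=
  have := H a b; rewrite /plane_point /minor /=; decide_letters; rewrite /=; clean.

Lemma unzip_sum (V : zmodType) (e1 s1 e2 s2 e3 s3 : V) :
  e1 + (s1 + (e2 + (s2 + (e3 + s3)))) = e1 + (e2 + e3) + (s1 + (s2 + s3)).
Proof. by rewrite [RHS]addrACA (addrACA e2) -!addrA. Qed.

(** Four letters i <= j <= k <= l, with coefficients numbered as in the list of
    normal forms: t0 for the word, t1, t3, t5 for the terms with one commutator,
    t2, t4, t6 for the terms with two.  The abstract functions [g], [g1], [g2]
    below stand for these terms, in the free algebra as well as in the Weyl
    algebra: the combinations are zero as soon as a commutator with equal
    entries is. *)
Section Degree4.
Variables (i j k l : nat) (t0 t1 t2 t3 t4 t5 t6 : F).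
Hypotheses (leij : (i <= j)%N) (lejk : (j <= k)%N) (lekl : (k <= l)%N).
Hypothesis H : forall a b, let v := plane_point a b in let d := minor a b in
  t0 *: (v i * (v j * (v k * v l)))
  + ((t1 * d i j) *: (v k * v l) + ((t2 * d i j * d k l)%:A
  + ((t3 * d i k) *: (v j * v l) + ((t4 * d i k * d j l)%:A
  + ((t5 * d i l) *: (v j * v k) + (t6 * d i l * d j k)%:A))))) = 0.

Lemma sorted_word_coef_deg4 : t0 = 0.
Proof.
at_point H (fun _ : nat => 1 : F) (fun _ : nat => 0 : F).
exact: (@scale_xX_eq0 t0 4).
Qed.

(** The terms with one commutator cancel.  Putting every letter but one equal to
    x isolates t5 (letter l), t3 (letter k) or t1 (letter j) as far as that
    letter differs from its neighbours, and t1 + t3 + t5 (letter i). *)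
Lemma commutator_coefs_deg4 (M : lmodType F) (g : nat -> nat -> nat -> nat -> M) :
    (forall p q r, g p p q r = 0) ->
  t1 *: g i j k l + (t3 *: g i k j l + t5 *: g i l j k) = 0.
Proof.
move=> g0; move: H; rewrite sorted_word_coef_deg4 => H0.
have xx0 (t : F) : t *: (x * x) = 0 -> t = 0 by exact: (@scale_xX_eq0 t 2).
have xx0N (t : F) : - t *: (x * x) = 0 -> t = 0.
  by move/xx0/eqP; rewrite oppr_eq0 => /eqP.
have t5_0 : (k < l)%N -> t5 = 0.
  move=> ltkl; at_point H0 (fun _ : nat => 1 : F) (fun p => (p == l)%:R : F).
  by move/xx0N.
have t3_0 : (j < k)%N -> (k < l)%N -> t3 = 0.
  move=> ltjk ltkl; at_point H0 (fun _ : nat => 1 : F) (fun p => (p == k)%:R : F).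
  by move/xx0N.
have t1_0 : (i < j)%N -> (j < k)%N -> t1 = 0.
  move=> ltij ltjk; at_point H0 (fun _ : nat => 1 : F) (fun p => (p == j)%:R : F).
  by move/xx0N.
have t135_0 : (i < j)%N -> t1 + (t3 + t5) = 0.
  move=> ltij; at_point H0 (fun _ : nat => 1 : F) (fun p => (p == i)%:R : F).
  by rewrite -!scalerDl => /xx0.
(* Here only two letters i < k occur, and the terms with two commutators do not
   vanish.  They take the same value at x_i = y and at x_i = x + y (x_k = x), so
   the difference of the two evaluations leaves (t3 + t5) x^2. *)
have t35_0 : i = j -> (j < k)%N -> k = l -> t3 + t5 = 0.
  move=> eqij ltjk eqkl.
  at_point H0 (fun p => (p != i)%:R : F) (fun p => (p == i)%:R : F).
  move=> Hy.
  at_point H0 (fun _ : nat => 1 : F) (fun p => (p == i)%:R : F).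
  rewrite mulrDl !scalerDr => Hxy; apply: xx0; rewrite scalerDl.
  rewrite -[RHS](subrr 0) -[X in X - _]Hxy -[X in _ - X]Hy.
  apply/esym/eqP; rewrite subr_eq -!addrA; apply/eqP; congr (_ + _).
  by rewrite (addrCA t4%:A); apply: addrCA.
have [eqij|neij] := eqVneq i j; have [eqjk|nejk] := eqVneq j k;
  have [eqkl|nekl] := eqVneq k l.
- by rewrite -eqkl -eqjk -eqij !g0 !scaler0 !addr0.
- by rewrite t5_0 ?scale0r -?eqjk -?eqij ?g0 ?scaler0 ?addr0 //; lia.
- rewrite -eqkl -eqij g0 scaler0 add0r -scalerDl t35_0 ?scale0r //; lia.
- rewrite -eqij g0 t3_0 ?t5_0 ?scaler0 ?scale0r ?addr0 //; lia.
- rewrite -eqkl -eqjk -!scalerDl t135_0 ?scale0r //; lia.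
- have t5z : t5 = 0 by apply: t5_0; lia.
  have := t135_0; rewrite t5z addr0 -eqjk scale0r addr0 -scalerDl => ->.
    by rewrite scale0r.
  by lia.
- have t1z : t1 = 0 by apply: t1_0; lia.
  have := t135_0; rewrite t1z add0r -eqkl scale0r add0r -scalerDl => ->.
    by rewrite scale0r.
  by lia.
- by rewrite t1_0 ?t3_0 ?t5_0 ?scale0r ?addr0 //; lia.
Qed.

(** The terms with one commutator are removed as elements, not only by their
    leading parts, so the scalar terms must cancel by themselves. *)
Lemma central_coefs_deg4 a b : let d := minor a b in
  t2 * d i j * d k l + (t4 * d i k * d j l + t6 * d i l * d j k) = 0.
Proof.
move=> d; have := H a b.
pose g p q r s := d p q *: (plane_point a b r * plane_point a b s).
have g0 p q r : g p p q r = 0 by rewrite /g /d /minor mulrC subrr scale0r.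
rewrite /= sorted_word_coef_deg4 scale0r add0r unzip_sum -/d.
have := commutator_coefs_deg4 g0; rewrite /g !scalerA => ->.
rewrite add0r -!scalerDl => /eqP.
by rewrite scaler_eq0 oner_eq0 orbF => /eqP.
Qed.

(** The coefficients left after c_il c_jk has been replaced by
    c_ik c_jl - c_ij c_kl according to T4. *)
Lemma plucker_coefs_deg4 (M : lmodType F) (g : nat -> nat -> nat -> nat -> M) :
    (forall p q r, g p p q r = 0) -> (forall p q r, g p q r r = 0) ->
  (t2 - t6) *: g i j k l + (t4 + t6) *: g i k j l = 0.
Proof.
move=> g0 g0'; have C := central_coefs_deg4.
have t46_0 : (j < k)%N -> t4 + t6 = 0.
  by move=> ltjk; at_point C (fun _ : nat => 1 : F) (fun p => (j < p)%:R : F).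
have t26_0 : (i < j)%N -> (j < k)%N -> (k < l)%N -> t2 - t6 = 0.
  move=> ltij ltjk ltkl.
  by at_point C (fun _ : nat => 1 : F) (fun p => ((p == j) || (p == l))%:R : F).
have t24_0 : (i < j)%N -> j = k -> (k < l)%N -> t2 + t4 = 0.
  move=> ltij eqjk ltkl.
  at_point C (fun _ : nat => 1 : F) (fun p => (p == j)%:R : F).
  by rewrite -opprD => /eqP; rewrite oppr_eq0 => /eqP.
have [eqjk|nejk] := eqVneq j k; last first.
  rewrite t46_0 ?scale0r ?addr0; last by lia.
  have [->|neij] := eqVneq i j; first by rewrite g0 scaler0.
  have [->|nekl] := eqVneq k l; first by rewrite g0' scaler0.
  by rewrite t26_0 ?scale0r //; lia.
rewrite -eqjk -scalerDl (_ : t2 - t6 + (t4 + t6) = t2 + t4); last by ring.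
have [->|neij] := eqVneq i j; first by rewrite g0 scaler0.
have [->|nejl] := eqVneq j l; first by rewrite g0' scaler0.
by rewrite t24_0 ?scale0r //; lia.
Qed.

Lemma normal_form_deg4 (M : lmodType F) (m : M)
    (g1 g2 : nat -> nat -> nat -> nat -> M) :
    (forall p q r, g1 p p q r = 0) ->
    (forall p q r, g2 p p q r = 0) -> (forall p q r, g2 p q r r = 0) ->
  t0 *: m + (t1 *: g1 i j k l + (t2 *: g2 i j k l + (t3 *: g1 i k j l
    + (t4 *: g2 i k j l + (t5 *: g1 i l j k + t6 *: g2 i l j k))))) =
  t6 *: (g2 i j k l - g2 i k j l + g2 i l j k).
Proof.
move=> g10 g20 g20'; rewrite sorted_word_coef_deg4 scale0r add0r.
have := commutator_coefs_deg4 g10; have := plucker_coefs_deg4 g20 g20'.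
rewrite scalerBl scalerDl scalerDr scalerBr.
set e1 := t1 *: _; set e2 := t3 *: _; set e3 := t5 *: _.
set s1 := t2 *: _; set s2 := t4 *: _; set s3 := t6 *: g2 i l j k.
set p := t6 *: _; set q := t6 *: _ => S E.
rewrite unzip_sum E add0r; apply/eqP; rewrite -subr_eq0 addrA opprD addrACA subrr.
by rewrite addr0 opprD addrACA opprK S.
Qed.

End Degree4.

Section Degree3.
Variables (i j k : nat) (t0 t1 t2 : F).
Hypotheses (leij : (i <= j)%N) (lejk : (j <= k)%N).
Hypothesis H : forall a b, let v := plane_point a b in let d := minor a b in
  t0 *: (v i * (v j * v k)) + ((t1 * d i j) *: v k + (t2 * d i k) *: v j) = 0.

Lemma normal_form_deg3 (M : lmodType F) (m : M) (g : nat -> nat -> nat -> M) :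
    (forall p q, g p p q = 0) ->
  t0 *: m + (t1 *: g i j k + t2 *: g i k j) = 0.
Proof.
move=> g0; move: H; have -> : t0 = 0.
  at_point H (fun _ : nat => 1 : F) (fun _ : nat => 0 : F).
  exact: (@scale_xX_eq0 t0 3).
move=> H0; have x0 (t : F) : t *: x = 0 -> t = 0 by exact: (@scale_xX_eq0 t 1).
have t2_0 : (j < k)%N -> t2 = 0.
  move=> ltjk; at_point H0 (fun _ : nat => 1 : F) (fun p => (p == k)%:R : F).
  by move/x0/eqP; rewrite oppr_eq0 => /eqP.
have t12_0 : (i < j)%N -> t1 + t2 = 0.
  move=> ltij; at_point H0 (fun _ : nat => 1 : F) (fun p => (p == i)%:R : F).
  by rewrite -scalerDl => /x0.
rewrite scale0r add0r; have [eqij|neij] := eqVneq i j.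
  rewrite -eqij g0 scaler0 add0r; have [<-|nejk] := eqVneq j k.
    by rewrite -eqij g0 scaler0.
  by rewrite t2_0 ?scale0r //; lia.
have [<-|nejk] := eqVneq j k; first by rewrite -scalerDl t12_0 ?scale0r //; lia.
have t2z : t2 = 0 by apply: t2_0; lia.
by have := t12_0; rewrite t2z addr0 scale0r addr0 => ->; rewrite ?scale0r //; lia.
Qed.

End Degree3.

Section Degree2.
Variables (i j : nat) (t0 t1 : F).
Hypotheses (leij : (i <= j)%N).
Hypothesis H : forall a b, let v := plane_point a b in let d := minor a b in
  t0 *: (v i * v j) + (t1 * d i j)%:A = 0.

Lemma normal_form_deg2 (M : lmodType F) (m : M) (g : nat -> nat -> M) :
    (forall p, g p p = 0) -> t0 *: m + t1 *: g i j = 0.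
Proof.
move=> g0; move: H; have -> : t0 = 0.
  at_point H (fun _ : nat => 1 : F) (fun _ : nat => 0 : F).
  exact: (@scale_xX_eq0 t0 2).
move=> H0; rewrite scale0r add0r; have [<-|neij] := eqVneq i j.
  by rewrite g0 scaler0.
at_point H0 (fun _ : nat => 1 : F) (fun p => (p == i)%:R : F).
by move/eqP; rewrite scaler_eq0 oner_eq0 orbF => /eqP ->; rewrite scale0r.
Qed.

End Degree2.

Local Notation J := (@letter_ideal F).
Local Notation spanJ := (span_mod J).
Local Notation comm := (@comm F).
Local Notation word := (@word F).

Lemma sum_cons (V : nmodType) (I : Type) (i : I) r (g : I -> V) :
  \sum_(j <- i :: r) g j = g i + \sum_(j <- r) g j.
Proof. exact: big_cons. Qed.

Lemma sum_seq1 (V : nmodType) (I : Type) (i : I) (g : I -> V) :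
  \sum_(j <- [:: i]) g j = g i.
Proof. exact: big_seq1. Qed.

(** Elements of the ideal vanish at the points of the plane, so the relation
    between the normal forms and [u] turns into a relation between values. *)
Lemma span_normal_forms_eval n s u : spanJ (normal_forms gen n s) u ->
    (forall a b, eval (plane_point a b) u = 0) ->
  exists t : seq F, [/\
    size t = size (normal_forms (gen : nat -> freeAlg F nat) n s),
    u - \sum_(p <- zip t (normal_forms gen n s)) p.1 *: p.2 \in J &
    forall a b,
      \sum_(p <- zip t (normal_forms (plane_point a b) n s)) p.1 *: p.2 = 0].
Proof.
move=> /span_modP[t szt Ju] u0; exists t; split=> // a b.
have -> : normal_forms (plane_point a b) n s =
    [seq eval (plane_point a b) f | f <- normal_forms gen n s].
  rewrite (map_normal_forms (eval (plane_point a b))); congr normal_forms.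
  by apply/funext => p /=; rewrite eval_gen.
have := letter_ideal_eval0 a b Ju.
rewrite raddfB /= u0 sub0r => /eqP; rewrite oppr_eq0 => /eqP; rewrite raddf_sum /=.
under eq_bigr do rewrite linearZ /=.
move=> E; rewrite -[RHS]E; elim: {szt Ju E} t (normal_forms _ n s) => [|c t IH] [|f B] /=;
  rewrite ?big_nil // !big_cons /= IH //.
Qed.

Lemma low_degree_identity s u :
    sorted leq s -> (size s <= 4)%N -> spanJ (normal_forms gen (size s) s) u ->
  (forall a b, eval (plane_point a b) u = 0) -> u \in J.
Proof.
move=> sorted_s le4 span_u id_u.
have [t [szt Ju E]] := span_normal_forms_eval span_u id_u.
pose B := normal_forms (gen : nat -> freeAlg F nat) (size s) s.
suff : \sum_(p <- zip t B) p.1 *: p.2 \in J.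
  by move=> JE; have := rpredD Ju JE; rewrite subrK.
have comm0 p (z : freeAlg F nat) : comm p p * z = 0.
  rewrite [comm p p]lie_diag; exact: mul0r.
have comm0' p q r (z : freeAlg F nat) : comm p q * (comm r r * z) = 0.
  exact: etrans (congr1 _ (comm0 r _)) (mulr0 _).
rewrite /B; case: s sorted_s le4 {span_u B} szt {Ju} E => [|i [|j [|k [|l [|m s]]]]] //.
- move=> _ _; case: t => [|t0 [|t1 t]] // _ E.
  have := E (fun _ => 1) (fun _ => 0); rewrite !big_seq1 /= big_nil => /eqP.
  rewrite scaler_eq0 oner_eq0 orbF => /eqP ->.
  by rewrite [X in X \in _]scale0r rpred0.
- move=> _ _; case: t => [|t0 [|t1 t]] // _ E.
  have := E (fun _ => 1) (fun _ => 0); rewrite /= !big_seq1 /=.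
  rewrite /plane_point scale1r scale0r addr0 => /(@scale_xX_eq0 _ 1) ->.
  by rewrite [X in X \in _]scale0r rpred0.
- move=> /andP[leij _] _; case: t => [|t0 [|t1 [|t2 t]]] // _ E.
  rewrite sum_cons sum_seq1 /=.
  rewrite [X in X \in _](normal_form_deg2 leij _ _
    (g := fun p q => comm p q * word [::])) ?rpred0 // => a b.
  have := E a b; rewrite sum_cons sum_seq1 /= !big_cons !big_nil !mulr1.
  by rewrite lie_plane_point !scalerA.
- move=> /and3P[leij lejk _] _; case: t => [|t0 [|t1 [|t2 [|t3 t]]]] // _ E.
  rewrite 2!sum_cons sum_seq1 /=.
  rewrite [X in X \in _](normal_form_deg3 leij lejk _ _
    (g := fun p q r => comm p q * word [:: r])) ?rpred0 // => a b.
  have := E a b; rewrite 2!sum_cons sum_seq1 /= !big_cons !big_nil !mulr1.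
  by rewrite !lie_plane_point !mulr_algl !scalerA.
move=> /and4P[leij lejk lekl _] _.
case: t => [|t0 [|t1 [|t2 [|t3 [|t4 [|t5 [|t6 [|t7 t]]]]]]]] // _ E.
pose g p q r r' := comm p q * (comm r r' * word [::]).
rewrite 6!sum_cons sum_seq1 /=.
rewrite [X in X \in _](normal_form_deg4 leij lejk lekl _ _
    (g1 := fun p q r r' => comm p q * word [:: r; r']) (g2 := g)); first last.
- by move=> p q r; apply: comm0'.
- by move=> p q r; apply: comm0.
- by move=> p q r; apply: comm0.
- move=> a b; have := E a b.
  rewrite 6!sum_cons sum_seq1 /= !big_cons !big_nil !mulr1.
  by rewrite !lie_plane_point !mulr_algl !scalerA.
apply: letter_idealZ.
have gE p q r r' : g p q r r' = comm p q * comm r r'.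
  by congr (_ * _); rewrite /word big_nil; exact: mulr1.
rewrite !gE [X in X \in _]t4_exchange.
apply: rpredB; last exact: comm_central.
exact/letter_rel_in/T4_rel.
Qed.

End Plane.

Theorem proposition7p1 (F : fieldType)
    (F_infinite : infinite_set [set: F]%classic)
    (f : freeAlg F nat)
    (f_identity : weak_identity (@weyl_V F) f)
    (f_degree : degree f = 4%N) :
  L_ideal [:: Gamma3; St3; T4] f.
Proof.
apply: letter_ideal_L_ideal.
have VZ (t : F) v : @weyl_V F v -> weyl_V (t *: v).
  by move=> [a [b ->]]; exists (t * a), (t * b); rewrite scalerDr !scalerA.
have eq_f := sum_words f.
set r := [seq _ | _ <- _] in eq_f; set a := fun w => f@_(FMonom w).
have {}eq_f : f = lincomb a r := eq_f.
rewrite eq_f.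
apply: (multihomogeneous_ind (J := fun g => g \in @letter_ideal F) VZ F_infinite).
- exact: rpred0.
- by move=> g h; apply: rpredD.
- move=> s r' sr eq_s id_r'.
  pose s' := sort leq s.
  have eq_ss' : perm_eq s s' by rewrite perm_sym perm_sort.
  apply: (low_degree_identity (weyl_yx F) (@weyl_xX_neq0 F) (s := s')).
  + exact: (sort_sorted leq_total).
  + rewrite size_sort -f_degree; case/mapP: sr => m mf ->.
    exact: (leq_bigmax_seq m mf).
  + apply: (span_mod_sum (letter_ideal_left _)) => w wr'.
    by apply: span_normal_forms => //; rewrite -(permPl (eq_s w wr')).
  + by move=> b c; apply: id_r' => i; exists (b i), (c i).
- by rewrite -eq_f.
Qed.
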